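(* Let $d\ge2$ and let $f(x)=x^d+c_1/c_2\in\mathbb{Q}[x]$, where $c_1\in\mathbb{Z}$ and $c_2\in\mathbb{Z}^+$ are relatively prime. For $m\ge 1$ put $F_0^m=c_2^{d^{m-1}}f^m(0)$. If $f(x)$ has a rational periodic point of exact period $n$, then $F_0^n$ has at least $n-1$ distinct primitive prime divisors.
   Context: The iterates of $f$ are $f^1=f$ and $f^m(x)=f(f^{m-1}(x))$ for $m\ge 2$. The superscript in $F_0^m$ is an index, not a power. A point $u\in\mathbb{Q}$ is a periodic point of exact period $n$ if $n$ is the smallest positive integer with $f^n(u)=u$. For a sequence $x_1,x_2,\ldots$ of integers, a primitive prime divisor of the term $x_n$ is a prime $p$ with $\nu_p(x_n)>0$ and $\nu_p(x_m)=0$ for every $m<n$; here this is applied to the sequence $F_0^1,F_0^2,\ldots$. *)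

(* Defs.v *)
From mathcomp Require Import all_boot all_order all_algebra.

Set Implicit Arguments.
Unset Strict Implicit.
Unset Printing Implicit Defensive.

Import Order.TTheory GRing.Theory Num.Theory.
Local Open Scope ring_scope.

Definition unicritical (d : nat) (c1 c2 : int) : {poly rat} :=
  'X^d + (c1%:~R / c2%:~R)%:P.

Definition poly_iter (f : {poly rat}) (m : nat) (x : rat) : rat :=
  iter m (horner f) x.

Definition exact_period (f : {poly rat}) (u : rat) (n : nat) : Prop :=
  [/\ (0 < n)%N, poly_iter f n u = u
    & forall m : nat, (0 < m < n)%N -> poly_iter f m u <> u].

(* The product is an integer for m >= 1 (see F0E), so that taking the numerator
   only changes its type from rat to int. *)
Definition F0 (d : nat) (c1 c2 : int) (m : nat) : int :=
  numq (c2%:~R ^+ (d ^ m.-1) * poly_iter (unicritical d c1 c2) m 0).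

Lemma F0E (d : nat) (c1 c2 : int) (m : nat) :
  (0 < d)%N -> c2 != 0 -> (0 < m)%N ->
  (F0 d c1 c2 m)%:~R
    = c2%:~R ^+ (d ^ m.-1) * poly_iter (unicritical d c1 c2) m 0 :> rat.
Proof.
move=> d_gt0 c2_neq0 m_gt0.
suff [z Dz] : exists z : int,
    c2%:~R ^+ (d ^ m.-1) * poly_iter (unicritical d c1 c2) m 0 = z%:~R.
  by rewrite /F0 Dz numq_int.
have c2Q_neq0 : c2%:~R != 0 :> rat by rewrite intr_eq0.
case: m m_gt0 => // m _; rewrite succnK; elim: m => [|m [z IHm]].
  exists c1; rewrite /poly_iter /unicritical /= !hornerE /= expr0n.
  by rewrite -[d == 0]negbK -lt0n d_gt0 /= add0r expr1 mulrCA divff ?mulr1.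
exists (z ^+ d + c1 * c2 ^+ (d ^ m.+1).-1).
have -> : poly_iter (unicritical d c1 c2) m.+2 0
    = poly_iter (unicritical d c1 c2) m.+1 0 ^+ d + c1%:~R / c2%:~R.
  by rewrite {1}/poly_iter iterS {1}/unicritical !hornerE.
rewrite mulrDr {1}expnSr exprM -exprMn IHm rmorphD rmorphM !rmorphXn /=.
congr (_ + _); rewrite mulrCA; congr (_ * _).
by rewrite -{1}(prednK (_ : 0 < d ^ m.+1)%N) ?expn_gt0 ?d_gt0 // exprSr mulfK.
Qed.

(* None stands for +oo: logn has the convention logn p 0 = 0, whereas
   nu_p(0) = +oo. The terms F0 can vanish, e.g. for n = 2 and f = X^2 - 1. *)
Definition nu (p : nat) (x : int) : option nat :=
  if x == 0 then None else Some (logn p `|x|%N).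

Definition nu_gt0 (v : option nat) : bool := if v is Some k then (0 < k)%N else true.

Lemma nu_gt0_dvd (p : nat) (x : int) :
  prime p -> nu_gt0 (nu p x) = (p %| `|x|)%N.
Proof.
move=> p_pr; rewrite /nu; case: eqVneq => [->|x_neq0] /=; first by rewrite dvdn0.
by rewrite logn_gt0 mem_primes p_pr absz_gt0 x_neq0.
Qed.

(* Sequences are indexed from 1; the value x 0 is ignored. *)
Definition primitive_prime_divisor (x : nat -> int) (n p : nat) : Prop :=
  [/\ prime p, nu_gt0 (nu p (x n))
    & forall m : nat, (0 < m < n)%N -> nu p (x m) = Some 0%N].

(* Main.v *)
Require Import Defs.
From mathcomp Require Import all_boot all_order all_algebra.
From mathcomp Require Import ring zify.

Set Implicit Arguments.
Unset Strict Implicit.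
Unset Printing Implicit Defensive.

Import Order.TTheory GRing.Theory Num.Theory.
Local Open Scope ring_scope.

(** Let x_0, ..., x_(n-1) be the periodic cycle of f = X^d + c. Every x_i has the
    same denominator b in lowest terms, and b^d = c2 (orbit_denq): if, at some
    prime, the denominator of x_i were too large for this, its valuation would
    be multiplied by d at each step and could never come back; if it were too
    small, the next one would be too large. Write x_i = a_i / b, so that
      b^(d-1) a_(i+1) = a_i^d + c1.

    The numerators are pairwise coprime (orbits_meet_mod_prime). Indeed
    b^(d-1) (a_(i+1) - a_(j+1)) = (a_i - a_j) S, with S homogeneous of degree
    d - 1 >= 1 in a_i and a_j. So the power of p in the difference of two points
    never drops along the orbit, and grows strictly when p divides both a_i and
    a_j; on a cycle this forces a_i = a_j.

    Hence every prime p dividing some a_i is a primitive divisor of F_0^n. Modulo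
    p, the orbit of 0 is the orbit of x_i, so that p divides F_0^m if and only if
    it divides a_(i+m) (F0_orbit_mod); this happens for m = n, and for no m
    strictly between 0 and n by coprimality.

    It remains to see that at most one a_i is a unit, since then the n - 1 others
    have prime divisors, which are distinct by coprimality. In fact the absolute
    values of the x_i are distinct (periodic_abs_inj): for d even, f takes the
    same value at opposite points but is injective on the cycle; for d odd, f is
    increasing, so that a periodic point is fixed and n = 1. *)

(** * The integer sequence F_0^m *)

Lemma poly_iter_unicriticalS (d : nat) (c1 c2 : int) (m : nat) (x : rat) :
  poly_iter (unicritical d c1 c2) m.+1 x
    = poly_iter (unicritical d c1 c2) m x ^+ d + c1%:~R / c2%:~R.
Proof. by rewrite {1}/poly_iter iterS {1}/unicritical !hornerE. Qed.

Lemma F0_0 (d : nat) (c1 c2 : int) : F0 d c1 c2 0 = 0.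
Proof. by rewrite /F0 /poly_iter /= mulr0. Qed.

(** Because F_0^0 = 0 as well, this recurrence determines the whole sequence,
    with 0 rather than F_0^1 as initial value. *)
Lemma F0S (d : nat) (c1 c2 : int) (m : nat) :
  (0 < d)%N -> c2 != 0 ->
  F0 d c1 c2 m.+1 = F0 d c1 c2 m ^+ d + c1 * c2 ^+ (d ^ m).-1.
Proof.
move=> d_gt0 c2_neq0; have c2Q_neq0 : c2%:~R != 0 :> rat by rewrite intr_eq0.
apply: (@intr_inj rat); rewrite F0E // poly_iter_unicriticalS succnK.
rewrite rmorphD rmorphM !rmorphXn /= mulrDr; congr (_ + _); last first.
  rewrite mulrCA; congr (_ * _).
  by rewrite -{1}(prednK (_ : 0 < d ^ m)%N) ?expn_gt0 ?d_gt0 // exprSr mulfK.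
case: m => [|m].
  by rewrite F0_0 /poly_iter /= expr0n eqn0Ngt d_gt0 mulr0.
by rewrite F0E // exprMn -exprM -expnSr.
Qed.

(** * Denominators of a periodic orbit *)

Lemma denq_dvd (x : rat) (t : int) :
  (exists z : int, x * t%:~R = z%:~R) -> (denq x %| t)%Z.
Proof.
case=> z /(congr1 ( *%R (denq x)%:~R)); rewrite mulrA (mulrC _ x) -numqE.
rewrite -!intrM => /intr_inj eq_t.
have : (denq x %| numq x * t)%Z by rewrite eq_t dvdz_mulr.
by rewrite Gauss_dvdzr // coprimezE coprime_sym coprime_num_den.
Qed.

Lemma denqX (x : rat) (d : nat) : denq (x ^+ d) = denq x ^+ d.
Proof.
have -> : x ^+ d = (numq x ^+ d)%:~R / (denq x ^+ d)%:~R.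
  by rewrite !rmorphXn /= -expr_div_n divq_num_den.
rewrite coprimeq_den.
  by rewrite (negPf (expf_neq0 d (denq_neq0 x))) normrX normr_denq.
by rewrite !abszX coprimeXl // coprimeXr // coprime_num_den.
Qed.

Lemma logn_denqD (p : nat) (x y : rat) :
  (logn p `|denq (x + y)| <= maxn (logn p `|denq x|) (logn p `|denq y|))%N.
Proof.
have den_gt0 z : (0 < `|denq z|)%N by rewrite absz_gt0 denq_neq0.
rewrite -logn_lcm //; apply: dvdn_leq_log; first by rewrite lcmn_gt0 !den_gt0.
suff : (denq (x + y) %| lcmz (denq x) (denq y))%Z by rewrite dvdzE.
apply: denq_dvd; have := dvdz_lcml (denq x) (denq y).
have := dvdz_lcmr (denq x) (denq y).
case/dvdzP=> s eq_s /dvdzP[t eq_t]; exists (t * numq x + s * numq y).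
rewrite mulrDl {1}eq_t eq_s rmorphD !rmorphM /= !numqE; ring.
Qed.

(** The equality case of the ultrametric inequality logn_denqD, which is applied
    once more to x = (x + y) - y. *)
Lemma logn_denqD_lt (p : nat) (x y : rat) :
  (logn p `|denq y| < logn p `|denq x|)%N ->
  logn p `|denq (x + y)| = logn p `|denq x|.
Proof.
move=> lt_yx; have := logn_denqD p x y; have := logn_denqD p (x + y) (- y).
rewrite addrK denqN; lia.
Qed.

(** Prime by prime, let e_k and g be the exponents of p in the denominators of x k
    and c. If d e_k > g, the term x k ^+ d dominates and e_(k+1) = d e_k > e_k,
    again with d e_(k+1) > g, so the exponents grow for ever, against
    periodicity. If d e_k < g, then c dominates and e_(k+1) = g > 0, which brings
    back the first case as d g > g. *)
Lemma orbit_denq (d n : nat) (c : rat) (x : nat -> rat) :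
    (2 <= d)%N -> (0 < n)%N ->
    (forall k, x k.+1 = x k ^+ d + c) -> (forall k, x (n + k)%N = x k) ->
  forall k, denq (x k) ^+ d = denq c.
Proof.
move=> d_ge2 n_gt0 xS x_per k.
suff logn_eq p k' : (d * logn p `|denq (x k')| = logn p `|denq c|)%N.
  rewrite -[RHS]absz_denq -[LHS]gez0_abs ?exprn_ge0 ?denq_ge0 //; congr Posz.
  have pos z : (0 < `|denq z|)%N by rewrite absz_gt0 denq_neq0.
  apply: eqn_from_log => // [|p]; first by rewrite abszX expn_gt0 pos.
  by rewrite abszX lognX logn_eq.
have logX j : logn p `|denq (x j ^+ d)| = (d * logn p `|denq (x j)|)%N.
  by rewrite denqX abszX lognX.
have bounded j : (d * logn p `|denq (x j)| <= logn p `|denq c|)%N.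
  rewrite leqNgt; apply/negP=> big.
  have grow i : (logn p `|denq c| < d * logn p `|denq (x (i + j)%N)|)%N
     /\ (logn p `|denq (x j)| + i <= logn p `|denq (x (i + j)%N)|)%N.
    elim: i => [|i [IHb IHl]]; first by rewrite addn0.
    rewrite addSn xS logn_denqD_lt logX //; nia.
  have := (grow n).2; rewrite x_per; lia.
have := bounded k'; rewrite leq_eqVlt => /orP[/eqP // | small].
have := bounded k'.+1; rewrite xS addrC logn_denqD_lt ?logX //; nia.
Qed.

(** * Divisibility along the numerators *)

(** By induction on e, the power p ^ e divides the difference of the starting
    points: one step of the recurrence gains a factor p, because p divides both
    starting points, the later steps lose nothing, and after n steps the
    difference is back to its first value. So that difference is 0. *)
Lemma orbits_meet_mod_prime (d n : nat) (c b : int) (p : nat) (a a' : nat -> int) :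
    (2 <= d)%N -> (0 < n)%N -> prime p -> coprimez p b ->
    (forall k, b ^+ d.-1 * a k.+1 = a k ^+ d + c) ->
    (forall k, b ^+ d.-1 * a' k.+1 = a' k ^+ d + c) ->
    a n = a 0%N -> a' n = a' 0%N ->
    (p %| a 0%N)%Z -> (p %| a' 0%N)%Z ->
  a 0%N = a' 0%N.
Proof.
move=> d_ge2 n_gt0 p_pr co_pb aS a'S a_per a'_per p_a p_a'.
pose D k := a k - a' k.
have DS k : b ^+ d.-1 * D k.+1
    = D k * \sum_(i < d) a k ^+ (d.-1 - i) * a' k ^+ i.
  rewrite -subrXX /D mulrBr aS a'S; ring.
have dvd_step e k : (p%:Z ^+ e %| b ^+ d.-1 * D k)%Z = (p%:Z ^+ e %| D k)%Z.
  by rewrite Gauss_dvdzr // coprimezXl // coprimezXr.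
have dvd_all e : (p%:Z ^+ e %| D 0%N)%Z.
  elim: e => [|e IHe]; first by rewrite expr0 dvd1z.
  have dvd_later k : (p%:Z ^+ e.+1 %| D k.+1)%Z.
    elim: k => [|k IHk]; rewrite -dvd_step DS; last exact: dvdz_mulr.
    (* The extra factor p lies in the cofactor: all its terms have positive
       degree d - 1, hence contain a 0 or a' 0. *)
    rewrite exprSr dvdz_mul //; apply: rpred_sum => i _.
    have [i0 | i_gt0] := posnP i; last exact/dvdz_mull/dvdz_exp.
    by apply/dvdz_mulr/dvdz_exp => //; lia.
  by have := dvd_later n.-1; rewrite prednK // /D a_per a'_per.
apply/eqP; rewrite -subr_eq0; apply/negPn/negP=> D_neq0.
have := dvd_all `|D 0%N|%N; rewrite dvdzE abszX => /dvdn_leq.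
by rewrite absz_gt0 leqNgt ltn_expl ?prime_gt1 // => /(_ D_neq0).
Qed.

(** Modulo a 0 the orbit of a 0 / b is the orbit of 0. Both F_0^m and
    b ^ (d ^ m - 1) a_m are c2 ^ (d ^ (m - 1)) = b ^ (d ^ m) times the m-th
    iterate, so they obey the same recurrence. *)
Lemma F0_orbit_mod (d : nat) (c1 c2 b : int) (a : nat -> int) :
    (0 < d)%N -> c2 != 0 -> c2 = b ^+ d ->
    (forall k, b ^+ d.-1 * a k.+1 = a k ^+ d + c1) ->
  forall m, (a 0%N %| F0 d c1 c2 m - b ^+ (d ^ m).-1 * a m)%Z.
Proof.
move=> d_gt0 c2_neq0 c2E aS; elim=> [|m IHm].
  by rewrite F0_0 expr0 mul1r sub0r rpredN; apply: dvdzz.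
have dm_gt0 : (0 < d ^ m)%N by rewrite expn_gt0 d_gt0.
have eq_b : b ^+ (d ^ m.+1).-1 = b ^+ ((d ^ m).-1 * d) * b ^+ d.-1.
  by rewrite -exprD; congr (_ ^+ _); rewrite expnSr; nia.
have -> : F0 d c1 c2 m.+1 - b ^+ (d ^ m.+1).-1 * a m.+1
    = F0 d c1 c2 m ^+ d - (b ^+ (d ^ m).-1 * a m) ^+ d.
  rewrite F0S // eq_b -mulrA aS exprMn -exprM c2E -exprM (mulnC d); ring.
by rewrite subrXX dvdz_mulr.
Qed.

Lemma primitive_divisor_of_orbit (d n : nat) (c1 c2 b : int) (a : nat -> int)
    (p : nat) :
    (2 <= d)%N -> (0 < n)%N -> c2 != 0 -> c2 = b ^+ d ->
    (forall k, b ^+ d.-1 * a k.+1 = a k ^+ d + c1) ->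
    (forall k, a (n + k)%N = a k) ->
    (forall m, (0 < m < n)%N -> a m <> a 0%N) ->
    coprimez (a 0%N) b -> prime p -> (p %| a 0%N)%Z ->
  primitive_prime_divisor (F0 d c1 c2) n p.
Proof.
move=> d_ge2 n_gt0 c2_neq0 c2E aS a_per a_min co_ab p_pr p_a0.
have co_pb : coprimez p b by apply: coprimez_dvdl co_ab.
have p_F0 m : (p %| `|F0 d c1 c2 m|)%N = (p %| a m)%Z.
  have := F0_orbit_mod (ltnW d_ge2) c2_neq0 c2E aS m.
  move=> /(dvdz_trans p_a0) p_diff.
  rewrite -[LHS](@dvdzE p) -(@Gauss_dvdzr p (b ^+ (d ^ m).-1) (a m)) ?coprimezXr //.
  by rewrite -{1}(subrK (b ^+ (d ^ m).-1 * a m) (F0 _ _ _ _)) rpredDl.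
split=> // [|m lt_m].
  by rewrite nu_gt0_dvd // p_F0 -[n]addn0 a_per.
have pNF : ~~ (p %| `|F0 d c1 c2 m|)%N.
  rewrite p_F0; apply/negP=> p_am; apply: (a_min m lt_m).
  rewrite -[in LHS](addn0 m).
  apply: (@orbits_meet_mod_prime d n c1 b p (fun k => a (m + k)%N) a) => //.
  - by move=> k; rewrite addnS.
  - by rewrite addnC a_per addn0.
  - by rewrite -[n]addn0 a_per.
  - by rewrite addn0.
move: pNF; rewrite -nu_gt0_dvd //.
by case: (nu _ _) => [[|k]|].
Qed.

(** * Absolute values on a periodic cycle *)

Lemma periodic_iter_inj (T : Type) (g : T -> T) (u : T) (n : nat) :
    iter n g u = u -> (forall m, (0 < m < n)%N -> iter m g u <> u) ->
  forall i j, (i < n)%N -> (j < n)%N -> iter i g u = iter j g u -> i = j.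
Proof.
move=> g_per g_min i j; wlog lt_ij : i j / (i < j)%N.
  move=> H lt_in lt_jn eq_ij; case: (ltngtP i j) => // lt; first exact: H.
  by apply/esym/H.
move=> lt_in lt_jn eq_ij; case: (g_min (n - j + i)%N); first lia.
by rewrite iterD eq_ij -iterD subnK // ltnW.
Qed.

Lemma ltr_odd_pow (R : realDomainType) (d : nat) (x y : R) :
  odd d -> x < y -> x ^+ d < y ^+ d.
Proof.
move=> d_odd lt_xy; have d_neq0 : d != 0%N by case: d d_odd.
have [x_ge0 | x_lt0] := leP 0 x; first by rewrite ltrXn2r.
have [y_ge0 | y_lt0] := leP 0 y.
  by rewrite (@lt_le_trans _ _ 0) ?exprn_odd_lt0 ?exprn_odd_ge0.
have powN z : (- z) ^+ d = - z ^+ d.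
  by rewrite exprNn -signr_odd d_odd mulN1r.
by rewrite -ltrN2 -!powN ltrXn2r ?ltrN2 // oppr_ge0 ltW.
Qed.

Lemma increasing_periodic_fixed (R : realDomainType) (g : R -> R) (u : R)
    (n : nat) :
  {homo g : x y / x < y} -> (0 < n)%N -> iter n g u = u -> g u = u.
Proof.
move=> g_incr n_gt0 g_per.
have up : u < g u -> u < iter n g u.
  move=> lt_u; rewrite -(prednK n_gt0); elim: n.-1 => [|k IHk] //.
  by apply: lt_trans lt_u _; rewrite iterS; apply: g_incr.
have down : g u < u -> iter n g u < u.
  move=> lt_u; rewrite -(prednK n_gt0); elim: n.-1 => [|k IHk] //.
  by apply: lt_trans lt_u; rewrite iterS; apply: g_incr.
by case: (ltgtP u (g u)) => // [/up | /down]; rewrite g_per ltxx.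
Qed.

(** For d odd, f is increasing and n = 1. For d even, f depends on the absolute
    value only, and going around the rest of the cycle recovers a point from its
    image. *)
Lemma periodic_abs_inj (d : nat) (c1 c2 : int) (u : rat) (n : nat) :
    (2 <= d)%N -> exact_period (unicritical d c1 c2) u n ->
  forall i j, (i < n)%N -> (j < n)%N ->
    `|poly_iter (unicritical d c1 c2) i u| = `|poly_iter (unicritical d c1 c2) j u| ->
  i = j.
Proof.
move=> d_ge2 [n_gt0 f_per f_min] i j lt_in lt_jn.
set f := unicritical d c1 c2 in f_per f_min *; move=> eq_abs.
rewrite /poly_iter in f_per f_min eq_abs.
have fE x : f.[x] = x ^+ d + c1%:~R / c2%:~R by rewrite !hornerE.
have [d_odd | d_even] := boolP (odd d).
  have fix_u : f.[u] = u.
    apply: (@increasing_periodic_fixed _ (horner f) _ n) => // x y lt_xy.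
    by rewrite !fE ltrD2r ltr_odd_pow.
  have n_le1 : (n <= 1)%N by rewrite leqNgt; apply/negP=> /(f_min 1%N); apply.
  lia.
have f_abs x y : `|x| = `|y| -> f.[x] = f.[y].
  move/eqP; rewrite !fE eqr_norm2 => /orP[/eqP-> // | /eqP->].
  by rewrite exprNn -signr_odd (negPf d_even) mul1r.
apply: (@periodic_iter_inj _ (horner f) u n) => //.
have back k : iter k (horner f) u = iter n.-1 (horner f) (iter k.+1 (horner f) u).
  by rewrite -iterD addnC addSnnS prednK // iterD f_per.
by rewrite back (back j) !iterS (f_abs _ _ eq_abs).
Qed.

(** * Primitive prime divisors of F_0^n *)

Theorem corollary6p3 (d : nat) (hd : (2 <= d)%N) (c1 c2 : int) (hc2 : 0 < c2)
    (hc : coprimez c1 c2) (n : nat)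
    (hper : exists u : rat, exact_period (unicritical d c1 c2) u n) :
  exists s : seq nat,
    [/\ uniq s, (n.-1 <= size s)%N
      & forall p : nat, p \in s -> primitive_prime_divisor (F0 d c1 c2) n p].
Proof.
case: hper => u per_u; have [n_gt0 u_per u_min] := per_u.
have c2_neq0 : c2 != 0 by rewrite gt_eqF.
set x := fun k => poly_iter (unicritical d c1 c2) k u.
have xS k : x k.+1 = x k ^+ d + c1%:~R / c2%:~R by exact: poly_iter_unicriticalS.
have x_per k : x (n + k)%N = x k.
  by rewrite /x addnC /poly_iter iterD -/(poly_iter _ n u) u_per.
have x_abs_inj := periodic_abs_inj hd per_u.
have x_inj i j : (i < n)%N -> (j < n)%N -> x i = x j -> i = j.
  by move=> lt_in lt_jn eq_x; apply: x_abs_inj => //; rewrite -/(x i) eq_x.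
pose b := denq u; pose a k := numq (x k).
have den_c : denq (c1%:~R / c2%:~R) = c2.
  by rewrite coprimeq_den // (negPf c2_neq0) gtr0_norm.
have x_den k : denq (x k) ^+ d = c2.
  by rewrite (orbit_denq hd n_gt0 xS x_per) den_c.
have c2E : c2 = b ^+ d by rewrite -(x_den 0%N).
have x_b k : denq (x k) = b.
  apply: (@pexpIrn _ d (ltnW hd)); rewrite ?nnegrE ?denq_ge0 //.
  by rewrite x_den c2E.
have xE k : x k = (a k)%:~R / b%:~R by rewrite /a -(x_b k) divq_num_den.
have a_inj i j : a i = a j -> x i = x j by rewrite !xE => ->.
have co_ab k : coprimez (a k) b by rewrite -(x_b k); exact: coprime_num_den.
have aS k : b ^+ d.-1 * a k.+1 = a k ^+ d + c1.
  apply: (@intr_inj rat); rewrite rmorphD rmorphM !rmorphXn /= !numqE !x_b xS.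
  have c2Q : c2%:~R = b%:~R ^+ d :> rat by rewrite c2E rmorphXn.
  have c2Q_neq0 : c2%:~R != 0 :> rat by rewrite intr_eq0.
  have bd : b%:~R ^+ d.-1 * b%:~R = c2%:~R :> rat.
    by rewrite -exprSr prednK ?(ltnW hd).
  by rewrite mulrCA bd mulrDl divfK // exprMn -c2Q.
have a_per k : a (n + k)%N = a k by rewrite /a x_per.
have a_shiftS i k : b ^+ d.-1 * a (i + k.+1)%N = a (i + k)%N ^+ d + c1.
  by rewrite addnS.
have a_shift_per i k : a (i + (n + k))%N = a (i + k)%N by rewrite addnCA a_per.
(* If a i = 0 every prime divides it, whereas pdiv 0 = 1; the choice of 2 is
   arbitrary. *)
pose p i := if (0 < `|a i|)%N then pdiv `|a i| else 2%N.
have p_pr i : `|a i|%N != 1%N -> prime (p i) /\ (p i %| a i)%Z.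
  rewrite /p dvdzE /=; case: posnP => [-> | ai_gt0 ai_neq1]; first by [].
  by split; [apply: pdiv_prime; rewrite ltn_neqAle eq_sym ai_neq1 | apply: pdiv_dvd].
exists [seq p i | i <- iota 0 n & `|a i|%N != 1%N]; split.
(* A prime dividing two numerators forces them to be equal. *)
- rewrite map_inj_in_uniq ?filter_uniq ?iota_uniq // => i j.
  rewrite !mem_filter !mem_iota !add0n => /andP[ai_neq1 lt_in].
  case/andP=> aj_neq1 lt_jn eq_p; apply: x_inj => //; apply: a_inj.
  have [pi_pr pi_dvd] := p_pr i ai_neq1; have [_ pj_dvd] := p_pr j aj_neq1.
  rewrite -(addn0 i) -(addn0 j).
  apply: (@orbits_meet_mod_prime d n c1 b (p i) (fun k => a (i + k)%N) (fun k => a (j + k)%N)) => //.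
  + apply: coprimez_dvdl (co_ab i); exact: pi_dvd.
  + by have := a_shift_per i 0%N; rewrite addn0.
  + by have := a_shift_per j 0%N; rewrite addn0.
  + by rewrite addn0.
  + by rewrite addn0 eq_p.
(* Two unit numerators would give points with the same absolute value 1 / b. *)
- rewrite size_map size_filter -subn1 leq_subLR -{1}(size_iota 0 n).
  rewrite -(count_predC (fun i => `|a i|%N == 1%N) (iota 0 n)) leq_add2r.
  rewrite -size_filter.
  have := filter_uniq (fun i => `|a i|%N == 1%N) (iota_uniq 0 n).
  have := fun i => mem_filter (fun i => `|a i|%N == 1%N) i (iota 0 n).
  case: (filter _ _) => [|i [|j t]] // mem_t /=; rewrite inE negb_or.
  case/andP=> /andP[/eqP neq_ij _] _; case: neq_ij.
  move: (mem_t i) (mem_t j); rewrite !inE !eqxx orbT !mem_iota !add0n.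
  move=> /esym /andP[/eqP ai1 lt_in] /esym /andP[/eqP aj1 lt_jn].
  apply: x_abs_inj => //; rewrite -/(x i) -/(x j) !xE !normrM; congr (_ * _).
  by rewrite -!intr_norm -!abszE ai1 aj1.
move=> q /mapP[i]; rewrite mem_filter mem_iota add0n => /andP[ai_neq1 lt_in] ->.
have [pi_pr pi_dvd] := p_pr i ai_neq1.
apply: (@primitive_divisor_of_orbit d n c1 c2 b (fun k => a (i + k)%N)) => //.
(* The cycle read from x i has exact period n too; i + m may wrap past n. *)
- move=> m /andP[m_gt0 lt_mn]; rewrite addn0 => /a_inj eq_x.
  have [lt_imn | le_nim] := ltnP (i + m) n.
    have := x_inj _ _ lt_imn lt_in eq_x; lia.
  have lt_w : (i + m - n < n)%N by lia.
  move: eq_x; rewrite -(subnKC le_nim) x_per => /(x_inj _ _ lt_w lt_in); lia.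
- by rewrite addn0.
Qed.
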